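(* Let $s\ge 3$ be an odd integer. Then the polynomial $$P_{s+1}(x)=\frac{s+1}{2^{s-1}}\left[\frac12\left(\frac{T_{s+1}(x)}{s+1}-\frac{T_{s-1}(x)}{s-1}\right)+\frac{1}{s^2-1}\right]$$ has $s+1$ distinct zeros $(c_i)_{i=0}^s$ on the interval $[-1,1]$, with $-1=c_0<c_1<\dots<c_s=1$. These zeros are symmetric about $0$.
   Context: $T_n$ denotes the Chebyshev polynomial of the first kind of degree $n$, i.e. $T_n(\cos\theta)=\cos(n\theta)$. *)

(* Defs.v *)
From HB Require Import structures.
From mathcomp Require Import all_boot all_order all_algebra.
From mathcomp Require Import reals trigo.
From mathcomp Require Import ring.

Set Implicit Arguments.
Unset Strict Implicit.
Unset Printing Implicit Defensive.

Import Order.TTheory GRing.Theory Num.Theory.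

Local Open Scope ring_scope.

(* T_n by the three-term recurrence; chebyTP shows that T_n is the only
   polynomial p such that p(cos t) = cos(n t) for all t. *)
Fixpoint chebyT (R : realType) (n : nat) : {poly R} :=
  match n with
  | 0 => 1
  | 1 => 'X
  | (m.+1 as k).+1 => 2 *: ('X * chebyT R k) - chebyT R m
  end.

Lemma chebyT_cos (R : realType) (n : nat) (t : R) :
  (chebyT R n).[cos t] = cos (n%:R * t).
Proof.
suff: (chebyT R n).[cos t] = cos (n%:R * t) /\
      (chebyT R n.+1).[cos t] = cos (n.+1%:R * t) by case.
elim: n => [|n [IH0 IH1]]; first by rewrite /= hornerC mul0r cos0 hornerX mul1r.
split=> //.
have -> : chebyT R n.+2 = 2 *: ('X * chebyT R n.+1) - chebyT R n by [].
rewrite hornerD hornerN hornerZ hornerM hornerX IH0 IH1.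
have -> : n.+2%:R * t = n.+1%:R * t + t by rewrite -[n.+2]addn1 natrD; ring.
have -> : n%:R * t = n.+1%:R * t - t by rewrite -[n.+1]addn1 natrD; ring.
rewrite cosB cosD; ring.
Qed.

Lemma chebyTP (R : realType) (n : nat) (p : {poly R}) :
  p = chebyT R n <-> (forall t : R, p.[cos t] = cos (n%:R * t)).
Proof.
split=> [-> t|hp]; first exact: chebyT_cos.
apply/eqP; rewrite -subr_eq0; apply/negPn/negP => q0.
pose x (k : nat) : R := k.+1%:R^-1.
have xin k : -1 <= x k <= 1.
  rewrite (le_trans (lerN10 R)) ?invr_ge0 ?ler0n //=.
  by rewrite invf_le1 ?ltr0n // ler1n.
have := @max_poly_roots R _ (map x (iota 0 (size (p - chebyT R n)))) q0.
rewrite size_map size_iota ltnn => H; suff: false by []; apply: H.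
- apply/allP => _ /mapP[k _ ->]; rewrite rootE hornerD hornerN.
  by rewrite -(acosK (xin k)) hp chebyT_cos subrr.
- rewrite map_inj_uniq ?iota_uniq // => i j /invr_inj /eqP.
  by rewrite eqr_nat => /eqP [].
Qed.

Lemma size_chebyT (R : realType) (n : nat) : size (chebyT R n) = n.+1.
Proof.
suff: size (chebyT R n) = n.+1 /\ size (chebyT R n.+1) = n.+2 by case.
elim: n => [|n [IH0 IH1]]; first by rewrite /= size_poly1 size_polyX.
split=> //.
have -> : chebyT R n.+2 = 2 *: ('X * chebyT R n.+1) - chebyT R n by [].
have sX : size (2 *: ('X * chebyT R n.+1)) = n.+3.
  by rewrite size_scale ?pnatr_eq0 // mulrC size_mulX -?size_poly_eq0 IH1.
by rewrite size_polyDl ?size_polyN sX // IH0.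
Qed.

(* P_(s+1), indexed by s: chebyP R s has degree s + 1. *)
Definition chebyP (R : realType) (s : nat) : {poly R} :=
  (s.+1%:R / 2 ^+ s.-1) *:
    (2^-1 *: (s.+1%:R^-1 *: chebyT R s.+1 - s.-1%:R^-1 *: chebyT R s.-1)
     + ((s%:R ^+ 2 - 1)^-1)%:P).

(* Main.v *)
Require Import Defs.
From mathcomp Require Import all_boot all_order all_algebra.
From mathcomp Require Import reals.
From mathcomp Require Import trigo ring lra.

Set Implicit Arguments.
Unset Strict Implicit.
Unset Printing Implicit Defensive.

Import Order.TTheory GRing.Theory Num.Theory.

Local Open Scope ring_scope.

(** On [-1, 1] put x = cos t. Since T_n(cos t) = cos (n t), the addition
    formulas turn P_(s+1)(cos t) into a positive constant times
      1 - cos (s t) cos t - s sin (s t) sin t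
    ([chebyP_cos]). It vanishes at t = 0, so x = 1 is a root, and x = -1 is one
    too because P_(s+1) is even for odd s. The derivative of P_(s+1) is a
    multiple of T_s, so its extremal points in ]-1, 1[ are the s numbers cos t
    with cos (s t) = 0. There sin (s t) is 1 and -1 in turn, and the
    value is a positive multiple of 1 - s sin t or 1 + s sin t. Hence the signs
    alternate as soon as 1 < s sin t, which is [one_lt_mul_sin].

    The intermediate value theorem gives s - 1 roots between consecutive
    extremal points. With the two endpoints these are s + 1 roots, as many as
    the degree allows, so there are no others. Finally x |-> - x preserves
    the set of roots and reverses their order; because a finite set has only one
    increasing enumeration ([increasing_image_eq]), the enumeration is
    symmetric about 0. *)

(** * Strictly increasing enumerations of roots *)

Lemma increasing_inj (R : numDomainType) (n : nat) (c : 'I_n -> R) :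
  (forall i j : 'I_n, (i < j)%N -> c i < c j) -> injective c.
Proof.
move=> cM i j cij; apply: val_inj; apply/eqP.
by case: ltngtP => // /cM; rewrite cij ltxx.
Qed.

(** Injectivity and equal cardinality make the inclusion of images an equality;
    listing both functions along ['I_n] then gives two strictly sorted sequences
    with the same elements, and these coincide. *)
Lemma increasing_image_eq (R : numDomainType) (n : nat) (c d : 'I_n -> R) :
  (forall i j : 'I_n, (i < j)%N -> c i < c j) ->
  (forall i j : 'I_n, (i < j)%N -> d i < d j) ->
  (forall i, exists j, d i = c j) -> d =1 c.
Proof.
have sorted_map_ord (f : 'I_n -> R) :
    (forall i j : 'I_n, (i < j)%N -> f i < f j) ->
    sorted <%R (map f (enum 'I_n)).
  move=> fM; apply: (@homo_sorted _ _ _ (relpre val ltn)) => //.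
  by rewrite -sorted_map val_enum_ord iota_ltn_sorted.
move=> cM dM dc i.
suff /eq_in_map eq_dc : map d (enum 'I_n) = map c (enum 'I_n).
  by apply: eq_dc; rewrite mem_enum.
apply: lt_sorted_eq; rewrite ?sorted_map_ord //.
have sub : {subset map d (enum 'I_n) <= map c (enum 'I_n)}.
  by move=> _ /mapP[k _ ->]; have [j ->] := dc k; rewrite map_f ?mem_enum.
apply: (uniq_min_size _ sub _).2; last by rewrite !size_map.
by rewrite map_inj_uniq ?enum_uniq //; apply: increasing_inj.
Qed.

Lemma root_enumeration (R : idomainType) (n : nat) (p : {poly R})
    (c : 'I_n -> R) :
  p != 0 -> (size p <= n.+1)%N -> injective c -> (forall i, root p (c i)) ->
  forall x, root p x <-> exists i, x = c i.
Proof.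
move=> p0 sp cI cr x; split=> [rx|[i ->]//].
suff /codomP : x \in codom c by [].
apply/negPn/negP => xc.
have /(max_poly_roots p0) : all (root p) (x :: codom c).
  by rewrite /= rx; apply/allP => _ /codomP[i ->].
rewrite /= xc map_inj_uniq ?enum_uniq // size_codom card_ord => /(_ isT).
by move=> /leq_trans/(_ sp); rewrite ltnn.
Qed.

Lemma poly_ivt_open (R : rcfType) (p : {poly R}) (a b : R) :
  a < b -> p.[a] * p.[b] < 0 -> exists x, [/\ a < x, x < b & root p x].
Proof.
move=> ab pab.
have [x /andP[ax xb] rx] : exists2 x, a <= x <= b & root p x.
  have [pa|pa] := leP p.[a] 0.
    by apply: (poly_ivt (ltW ab)); rewrite pa; nra.
  have [|x xab] := @poly_ivt _ (- p) _ _ (ltW ab).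
    by rewrite !hornerN; apply/andP; split; nra.
  by rewrite rootN; exists x.
exists x; split=> //; rewrite lt_neqAle ?ax ?xb andbT; apply: contraTneq pab.
  by move=> ->; rewrite (rootP rx) mul0r ltxx.
by move=> <-; rewrite (rootP rx) mulr0 ltxx.
Qed.

(** The endpoints [a] and [b] and the roots found between consecutive [e k] are
    described together: the [i]-th root lies above [e i.-1] unless [i] is the
    first index, and below [e i] unless [i] is the last. Monotonicity follows
    from this description alone. *)
Lemma interlacing_roots (R : rcfType) (n : nat) (p : {poly R}) (a b : R)
    (e : nat -> R) :
  root p a -> root p b -> a < e 0%N -> e n < b ->
  (forall k l, (k < l <= n)%N -> e k < e l) ->
  (forall k, (k < n)%N -> p.[e k] * p.[e k.+1] < 0) ->
  exists c : 'I_n.+2 -> R,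
    [/\ c ord0 = a, c ord_max = b,
        forall i j : 'I_n.+2, (i < j)%N -> c i < c j
      & forall i, root p (c i)].
Proof.
move=> ra rb ae eb eM palt.
have ex (i : 'I_n.+2) : exists x, [/\ root p x, (i == ord0 -> x = a),
    (i == ord_max -> x = b), ((0 < i)%N -> e i.-1 < x)
    & ((i < n.+1)%N -> x < e i)].
  case: i => -[|i] hi /=; first by exists a; split.
  have [ni|ni] := ltnP i n; last first.
    have iE : i = n by apply/eqP; rewrite eqn_leq ni andbT.
    by exists b; split=> //; rewrite iE // ltnn.
  have [|x [ex xe rx]] := poly_ivt_open _ (palt i ni).
    by apply: eM; rewrite ltnSn.
  exists x; split=> //; rewrite -val_eqE /= eqSS => /eqP ein.
  by rewrite ein ltnn in ni.
have [c hc] := fin_all_exists ex; exists c; split.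
- by have [_ ->] := hc ord0.
- by have [_ _ ->] := hc ord_max.
- move=> i j ij.
  have [_ _ _ _ ci] := hc i; have [_ _ _ cj _] := hc j.
  have in1 : (i < n.+1)%N by rewrite (leq_trans ij) // -ltnS.
  have j0 : (0 < j)%N by rewrite (leq_ltn_trans _ ij).
  apply: (lt_trans (ci in1)); apply: le_lt_trans (cj j0).
  have : (i <= j.-1)%N by rewrite -ltnS prednK.
  rewrite leq_eqVlt => /predU1P[-> //|ij']; apply/ltW/eM.
  by rewrite ij' -ltnS prednK // -[X in _ && X]ltnS ltn_ord.
- by move=> i; have [] := hc i.
Qed.

(** * The sine at the zeros of [cos (n t)] *)

(** By induction: the addition formula expresses the sine of (n + 1) t through
    those of n t and t, with cosine coefficients of absolute value at most 1. *)
Lemma norm_sin_mul_le (R : realType) (n : nat) (t : R) :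
  `|sin (n%:R * t)| <= n%:R * `|sin t|.
Proof.
elim: n => [|n IH]; first by rewrite !mul0r sin0 normr0.
rewrite -addn1 natrD !mulrDl !mul1r sinD.
apply: le_trans (ler_normD _ _) _; rewrite !normrM.
have cos1 u : `|cos u : R| <= 1 by rewrite ler_norml cos_geN1 cos_le1.
by apply: lerD; [apply: le_trans IH; rewrite ler_piMr | rewrite ler_piMl].
Qed.

Lemma sqr_sin_of_cos0 (R : realType) (t : R) : cos t = 0 -> sin t ^+ 2 = 1.
Proof. by move=> ct; have := cos2Dsin2 t; rewrite ct expr0n add0r. Qed.

(** [norm_sin_mul_le] alone gives 1 = |sin (n t)| <= n |sin t|; the strict
    inequality comes from one step less. As cos (n t) = 0, subtracting t
    gives |sin ((n - 1) t)| = |cos t|, so |cos t| <= (n - 1) |sin t|. Then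
    1 = cos^2 t + sin^2 t < (n - 1) |sin t| + |sin t|, because sin t cannot
    vanish and hence |cos t| < 1. *)
Lemma one_lt_mul_sin (R : realType) (n : nat) (t : R) :
  (1 < n)%N -> cos (n%:R * t) = 0 -> 1 < n%:R * `|sin t|.
Proof.
case: n => [//|n] n0 cn0.
have sn1 := sqr_sin_of_cos0 cn0.
have nE : n%:R * t = n.+1%:R * t - t by rewrite -[n.+1]addn1 natrD; ring.
have hs : `|sin (n%:R * t)| = `|cos t|.
  apply/eqP; rewrite -(@eqrXn2 _ 2) // -!normrX !ger0_norm ?sqr_ge0 //.
  by rewrite nE sinB cn0 mul0r subr0 exprMn sn1 mul1r.
have le := norm_sin_mul_le n t; rewrite hs in le.
have := cos2Dsin2 t; rewrite -(real_normK (num_real (cos t))).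
rewrite -(real_normK (num_real (sin t))).
have : 0 <= `|sin t| by [].
have : 0 <= `|cos t| by [].
have : 1 <= n%:R :> R by rewrite ler1n.
rewrite -[n.+1]addn1 natrD; move: le.
set x := `|sin t|; set y := `|cos t|; set m : R := n%:R => le m1 y0 x0 xy.
have xp : 0 < x.
  rewrite lt_def x0 andbT; apply/eqP => x00.
  by move: le xy; rewrite x00 mulr0; nra.
have y1 : y < 1 by nra.
have x1 : x <= 1 by nra.
have : y ^+ 2 <= y * (m * x) by rewrite expr2 ler_wpM2l.
have : x ^+ 2 <= x by nra.
have mx : 0 < m * x by nra.
have : y * (m * x) < m * x by nra.
by rewrite mulrDl mul1r => *; lra.
Qed.

(** * Values and sign changes of the polynomial *)

Lemma chebyT_opp (R : realType) (n : nat) (x : R) :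
  (chebyT R n).[- x] = (-1) ^+ n * (chebyT R n).[x].
Proof.
suff: (chebyT R n).[- x] = (-1) ^+ n * (chebyT R n).[x] /\
      (chebyT R n.+1).[- x] = (-1) ^+ n.+1 * (chebyT R n.+1).[x] by case.
elim: n => [|n [IH0 IH1]]; first by rewrite /= !hornerE mulN1r.
split=> //.
have -> : chebyT R n.+2 = 2 *: ('X * chebyT R n.+1) - chebyT R n by [].
by rewrite !(hornerD, hornerN, hornerZ, hornerM, hornerX) IH0 IH1 !exprS; ring.
Qed.

Lemma horner_chebyP (R : realType) (s : nat) (x : R) :
  (chebyP R s).[x] = s.+1%:R / 2 ^+ s.-1 *
    (2^-1 * (s.+1%:R^-1 * (chebyT R s.+1).[x]
             - s.-1%:R^-1 * (chebyT R s.-1).[x])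
     + (s%:R ^+ 2 - 1)^-1).
Proof.
rewrite /chebyP.
(* Opaque names keep the evaluation rules from unfolding the recurrence. *)
move: (chebyT R s.+1) (chebyT R s.-1) => p q.
by rewrite !(hornerD, hornerN, hornerZ, hornerC).
Qed.

Lemma chebyP_even (R : realType) (s : nat) (x : R) :
  odd s -> (chebyP R s).[- x] = (chebyP R s).[x].
Proof.
move=> os; rewrite !horner_chebyP !chebyT_opp.
rewrite -(signr_odd _ s.+1) -(signr_odd _ s.-1).
by case: s os => [//|s] /= os; rewrite negbK (negbTE os) !mul1r.
Qed.

(** The Chebyshev terms become the cosines of n t + t and n t - t; after
    expanding, the coefficients 1/(n+1) and 1/(n-1) combine over n^2 - 1. *)
Lemma chebyP_cos (R : realType) (n : nat) (t : R) : (1 < n)%N ->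
  (chebyP R n).[cos t] = n.+1%:R / 2 ^+ n.-1 / (n%:R ^+ 2 - 1) *
     (1 - cos (n%:R * t) * cos t - n%:R * (sin (n%:R * t) * sin t)).
Proof.
case: n => [//|n] n0.
rewrite horner_chebyP !chebyT_cos /=.
have -> : n.+2%:R * t = n.+1%:R * t + t by rewrite -[n.+2]addn1 natrD; ring.
have -> : n%:R * t = n.+1%:R * t - t by rewrite -[n.+1]addn1 natrD; ring.
rewrite cosB cosD.
set C := cos (_ * t); set S := sin (_ * t).
have : n%:R != 0 :> R by rewrite pnatr_eq0 -lt0n.
have : n%:R + 2 != 0 :> R by rewrite -natrD pnatr_eq0 addn2.
have -> : n.+2%:R = n%:R + 2 :> R by rewrite -addn2 natrD.
have -> : n.+1%:R = n%:R + 1 :> R by rewrite -addn1 natrD.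
have : 2 ^+ n != 0 :> R by rewrite expf_neq0 // pnatr_eq0.
move: (2 ^+ n) => K K0; move: (n%:R) => m m2 m0.
field; rewrite K0 m0 m2 !andbT.
have -> : (m + 1) ^+ 2 - 1 = m * (m + 2) by ring.
by rewrite mulf_neq0.
Qed.

Lemma chebyP_root1 (R : realType) (s : nat) : (1 < s)%N -> root (chebyP R s) 1.
Proof.
move=> s1; rewrite rootE -cos0 chebyP_cos // !mulr0 sin0 cos0.
by rewrite !mulr0 mulr1 subrr subr0 mulr0.
Qed.

Lemma size_chebyP (R : realType) (s : nat) : (size (chebyP R s) <= s.+2)%N.
Proof.
rewrite /chebyP; apply: leq_trans (size_scale_leq _ _) _.
apply: leq_trans (size_polyD _ _) _.
rewrite geq_max (leq_trans (size_polyC_leq1 _)) // andbT.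
apply: leq_trans (size_scale_leq _ _) _.
apply: leq_trans (size_polyD _ _) _; rewrite size_polyN geq_max.
apply/andP; split; apply: leq_trans (size_scale_leq _ _) _.
  by rewrite size_chebyT.
by rewrite size_chebyT ltnS (leq_trans (leq_pred s)).
Qed.

(** For k < s, the zeros in ]0, pi[ of the cosine of s t. *)
Definition extremal_angle (R : realType) (s k : nat) : R :=
  k.*2.+1%:R * (pi / (2 * s%:R)).

Lemma mul_extremal_angle (R : realType) (s k : nat) : (0 < s)%N ->
  s%:R * extremal_angle R s k = pi / 2 + pi *+ k.
Proof.
move=> s0; rewrite /extremal_angle -[k.*2.+1]addn1 natrD -muln2 natrM.
rewrite -mulr_natr.
have : s%:R != 0 :> R by rewrite pnatr_eq0 -lt0n.
by move=> ?; field.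
Qed.

Lemma cos_mul_extremal_angle (R : realType) (s k : nat) : (0 < s)%N ->
  cos (s%:R * extremal_angle R s k) = 0.
Proof.
move=> s0; rewrite mul_extremal_angle // (alternatingn (@cosDpi R)).
by rewrite cos_pihalf mulr0.
Qed.

Lemma sin_mul_extremal_angle (R : realType) (s k : nat) : (0 < s)%N ->
  sin (s%:R * extremal_angle R s k) = (-1) ^+ k.
Proof.
move=> s0; rewrite mul_extremal_angle // (alternatingn (@sinDpi R)).
by rewrite sin_pihalf mulr1.
Qed.

Lemma extremal_angle_lt (R : realType) (s k l : nat) : (0 < s)%N ->
  (k < l)%N -> extremal_angle R s k < extremal_angle R s l.
Proof.
move=> s0 kl; rewrite ltr_pM2r ?ltr_nat ?ltnS ?ltn_double //.
by rewrite divr_gt0 ?pi_gt0 // mulr_gt0 // ltr0n.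
Qed.

Lemma extremal_angle_itv (R : realType) (s k : nat) :
  (k < s)%N -> 0 < extremal_angle R s k < pi.
Proof.
move=> ks; have s0 : 0 < s%:R :> R by rewrite ltr0n (leq_ltn_trans _ ks).
have pi0 := pi_gt0 R.
rewrite /extremal_angle; apply/andP; split.
  by rewrite mulr_gt0 ?ltr0n // divr_gt0 // mulr_gt0.
rewrite mulrA ltr_pdivrMr ?mulr_gt0 // mulrC ltr_pM2l //.
by rewrite -natrM ltr_nat mul2n ltn_Sdouble.
Qed.

(** Up to a positive factor the left-hand side is (-1)^k - s sin t, and
    (-1)^k <= 1 < s sin t. *)
Lemma sign_chebyP_extremal (R : realType) (s k : nat) :
  (1 < s)%N -> (k < s)%N ->
  (-1) ^+ k * (chebyP R s).[cos (extremal_angle R s k)] < 0.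
Proof.
move=> s1 ks; have s0 : (0 < s)%N by rewrite ltnW.
rewrite chebyP_cos // cos_mul_extremal_angle // sin_mul_extremal_angle //.
have t0 := sin_gt0_pi (extremal_angle_itv R ks).
have := one_lt_mul_sin s1 (cos_mul_extremal_angle R k s0).
rewrite (gtr0_norm t0) mul0r subr0.
set x := sin _ => sx.
have C0 : 0 < s.+1%:R / 2 ^+ s.-1 / (s%:R ^+ 2 - 1) :> R.
  rewrite !divr_gt0 ?exprn_gt0 ?ltr0n //.
  by rewrite subr_gt0 -natrX ltr1n -(exp1n 2) ltn_exp2r.
rewrite mulrCA pmulr_rlt0 // mulrBr mulr1 mulrCA signrMK subr_lt0.
apply: le_lt_trans sx; rewrite (le_trans (ler_norm _)) //.
by rewrite normrX normrN1 expr1n.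
Qed.

Theorem theorem3p2 (R : realType) (s : nat) (hs : (3 <= s)%N) (hodd : odd s) :
  exists c : 'I_s.+1 -> R,
    [/\ c ord0 = -1,
        c ord_max = 1,
        forall i j : 'I_s.+1, (i < j)%N -> c i < c j,
        forall x : R, -1 <= x <= 1 ->
          (root (chebyP R s) x <-> exists i : 'I_s.+1, x = c i)
      & forall i : 'I_s.+1, c (rev_ord i) = - c i].
Proof.
have s1 : (1 < s)%N by apply: ltnW.
have s0 : (0 < s)%N by apply: ltnW.
have rN x : root (chebyP R s) (- x) = root (chebyP R s) x.
  by rewrite !rootE chebyP_even.
have r1 := chebyP_root1 R s1.
(* The cosine decreases on [0, pi], so its opposite lists the extremal points in
   increasing order; evenness leaves the values unchanged. *)
pose e k : R := - cos (extremal_angle R s k).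
have eP k : (chebyP R s).[e k] = (chebyP R s).[cos (extremal_angle R s k)].
  exact: chebyP_even.
have sgnP k : (k < s)%N -> (-1) ^+ k * (chebyP R s).[e k] < 0.
  by rewrite eP; apply: sign_chebyP_extremal.
have angle_in k : (k < s)%N -> extremal_angle R s k \in `[0, pi].
  by move=> /(extremal_angle_itv R)/andP[? ?]; rewrite in_itv /= !ltW.
have [||||||c [c0 cmax cM cr]] :=
    @interlacing_roots R s.-1 (chebyP R s) (-1) 1 e.
- by rewrite rN.
- by [].
- rewrite ltrN2 -[ltRHS](@cos0 R) ltr_cos ?angle_in //.
    by have /andP[] := extremal_angle_itv R s0.
  by rewrite in_itv /= lexx pi_ge0.
- rewrite ltrNl -(@cospi R) ltr_cos ?angle_in ?prednK //.
    by have /andP[] := @extremal_angle_itv R s s.-1 ltac:(by rewrite prednK).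
  by rewrite in_itv /= lexx pi_ge0.
- move=> k l /andP[kl ls]; have ls' : (l < s)%N by rewrite -ltnS prednK in ls.
  have ks : (k < s)%N by apply: ltn_trans ls'.
  by rewrite ltrN2 ltr_cos ?angle_in // extremal_angle_lt.
- move=> k ks; have ks' : (k.+1 < s)%N by rewrite -ltnS prednK in ks.
  have : 0 < (-1) ^+ k * (chebyP R s).[e k] *
             ((-1) ^+ k.+1 * (chebyP R s).[e k.+1]).
    by rewrite nmulr_rgt0 sgnP // ltnW.
  by rewrite exprS mulN1r mulNr mulrN mulrACA -expr2 sqrr_sign mul1r oppr_gt0.
move: c c0 cmax cM cr; rewrite prednK // => c c0 cmax cM cr.
have P0 : chebyP R s != 0.
  by apply: contraTneq (sgnP 0%N s0) => ->; rewrite horner0 mulr0 ltxx.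
have cP := root_enumeration P0 (size_chebyP R s) (increasing_inj cM) cr.
exists c; split=> // i.
(* The reflected enumeration i |-> - c (s - i) is increasing as well. *)
apply: oppr_inj; rewrite opprK; move: i.
apply: (@increasing_image_eq _ _ c (fun i => - c (rev_ord i)) cM).
  move=> i j ij; rewrite ltrN2; apply: cM => /=.
  by rewrite ltn_sub2l ?ltnS // (leq_trans ij) // -ltnS ltn_ord.
by move=> i; apply/cP; rewrite rN.
Qed.
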